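(* Let $\Gamma$ be a quotient-polynomial graph with adjacency matrix $A$ and exactly $d+1$ distinct eigenvalues, and let $\{F_0=I,F_1,\ldots,F_d\}$ be the standard basis of $\mathcal{A}=\operatorname{span}\{I,A,\ldots,A^d\}$. Let $F\in\{F_0,F_1,\ldots,F_d\}$. Then $F$ has $d+1$ distinct eigenvalues if and only if $\operatorname{span}\{F_0,F_1,\ldots,F_d\}=\operatorname{span}\{I,F,F^2,\ldots,F^d\}$.
   Context: $\Gamma$ is a finite, simple, connected, undirected graph with vertex set $X$. For $y,z\in X$ let $\mathbf{w}(y,z)=((A^0)_{yz},\ldots,(A^d)_{yz})^\top$; the walk-regular partition of $X\times X$ has classes consisting of pairs with equal vectors $\mathbf{w}$, and $\Gamma$ is quotient-polynomial if the $(0,1)$ adjacency matrix of each class belongs to $\mathcal{A}$. The standard basis of $\mathcal{A}$ is the basis $\{F_0,\ldots,F_d\}$ of $\mathcal{A}$ consisting of nonzero symmetric $(0,1)$-matrices with $F_i\circ F_j=\delta_{ij}F_i$ ($\circ$ the entrywise product), one of them equal to $I$, summing to the all-ones matrix $J$, and with each product $F_iF_j$ a linear combination of $F_0,\ldots,F_d$. *)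

(* Defs.v *)
From mathcomp Require Import all_boot all_order all_algebra.

Set Implicit Arguments.
Unset Strict Implicit.
Unset Printing Implicit Defensive.

Import GRing.Theory.
Local Open Scope ring_scope.

(* Matrices indexed by a finite type X are square matrices of size #|X|; row
   or column i stands for the vertex enum_val i. *)
Definition rel_mx (R : rcfType) (X : finType) (C : {set X * X}) :
    'M[R]_#|X| :=
  \matrix_(i, j) ((enum_val i, enum_val j) \in C)%:R.

Definition adjmx (R : rcfType) (X : finType) (e : rel X) : 'M[R]_#|X| :=
  rel_mx R [set p | e p.1 p.2].

Definition span_powers (R : rcfType) (n d : nat) (M : 'M[R]_n) :
    {vspace 'M[R]_n} :=
  <<[seq M ^+ k | k : 'I_d.+1]>>%VS.

(* Counts the eigenvalues lying in R; for the symmetric matrices considered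
   here these are all the eigenvalues. *)
Definition has_distinct_eigenvalues (R : rcfType) (n : nat) (M : 'M[R]_n)
    (k : nat) : Prop :=
  exists s : seq R,
    [/\ uniq s, size s = k & forall a, (a \in s) = eigenvalue M a].

Definition walk_vector (R : rcfType) (X : finType) (e : rel X) (d : nat)
    (y z : X) : 'cV[R]_d.+1 :=
  \col_k (adjmx R e ^+ k) (enum_rank y) (enum_rank z).

Definition walk_regular_partition (R : rcfType) (X : finType) (e : rel X)
    (d : nat) : {set {set X * X}} :=
  preim_partition (fun p => walk_vector R e d p.1 p.2) [set: X * X].

(* Meaningful when the graph has exactly d+1 distinct eigenvalues. *)
Definition quotient_polynomial (R : rcfType) (X : finType) (e : rel X)
    (d : nat) : Prop :=
  forall C, C \in walk_regular_partition R e d ->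
    rel_mx R C \in span_powers d (adjmx R e).

Definition hadamard (R : rcfType) (m n : nat) (M N : 'M[R]_(m, n)) :
    'M[R]_(m, n) :=
  map2_mx *%R M N.

Record standard_basis (R : rcfType) (n d : nat) (V : {vspace 'M[R]_n})
    (F : 'I_d.+1 -> 'M[R]_n) : Prop := StandardBasis {
  sb_basis : basis_of V [seq F i | i : 'I_d.+1];
  sb_neq0 : forall i, F i != 0;
  sb_sym : forall i, (F i)^T = F i;
  sb_01 : forall i x y, F i x y = 0 \/ F i x y = 1;
  sb_hadamard : forall i j,
    hadamard (F i) (F j) = if i == j then F i else 0;
  sb_id : exists i, F i = 1%:M;
  sb_sum : \sum_i F i = const_mx 1;
  sb_mul : forall i j, F i *m F j \in <<[seq F l | l : 'I_d.+1]>>%VS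
}.

(* Main.v *)
Require Import Defs.
From mathcomp Require Import all_boot all_order all_algebra.
Import GRing.Theory.
Local Open Scope ring_scope.

(** Having [d + 1] distinct eigenvalues forces the minimal polynomial of [F] to
have degree at least [d + 1], i.e. [I, F, ..., F^d] to be independent; they lie
in the algebra [span {F_i}], of dimension [d + 1], hence span it.  Conversely
write [F = q(A)] with [A] the adjacency matrix.  As the algebra contains
[A^(d+1)], the minimal polynomial of [A] is the product of the [X - a] over the
[d + 1] eigenvalues [a] of [A], so the minimal polynomial of [F] divides the
product of the [X - b] over the distinct values [b = q(a)].  It has degree at
least [d + 1] when the powers of [F] are independent, so the [q(a)] are
[d + 1] distinct eigenvalues. *)

Lemma horner_mx_comp (R : comNzRingType) (n : nat) (A : 'M[R]_n.+1)
    (p q : {poly R}) :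
  horner_mx A (p \Po q) = horner_mx (horner_mx A q) p.
Proof.
elim/poly_ind: p => [|p c IHp]; first by rewrite comp_poly0 !rmorph0.
rewrite comp_poly_MXaddC !rmorphD !rmorphM /= IHp.
by rewrite !horner_mx_C horner_mx_X.
Qed.

Section SpanPowers.

Variables (R : rcfType) (n d : nat).
Implicit Types (A B M : 'M[R]_n.+1) (p q : {poly R}).

Lemma span_powersE A :
  span_powers d A = <<[tuple A ^+ (k : 'I_d.+1) | k < d.+1]>>%VS.
Proof. by []. Qed.

Lemma horner_mx_poly A (c : nat -> R) :
  horner_mx A (\poly_(i < d.+1) c i) =
  \sum_(i < d.+1) c i *: [tuple A ^+ (k : 'I_d.+1) | k < d.+1]`_i.
Proof.
rewrite poly_def rmorph_sum; apply: eq_bigr => i _.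
by rewrite -tnth_nth tnth_mktuple /= linearZ rmorphXn /= horner_mx_X.
Qed.

Lemma mem_span_powersP A B :
  reflect (exists2 p : {poly R}, (size p <= d.+1)%N & B = horner_mx A p)
          (B \in span_powers d A).
Proof.
rewrite span_powersE; apply: (iffP idP) => [/coord_span -> | [p szp ->]].
  set t := [tuple _ | k < _].
  exists (\poly_(i < d.+1) coord t (inord i) B); first exact: size_poly.
  by rewrite horner_mx_poly; apply: eq_bigr => i _; rewrite inord_val.
have -> : p = \poly_(i < d.+1) p`_i.
  apply/polyP => i; rewrite coef_poly.
  by case: ltnP => // /(leq_trans szp)/leq_sizeP ->.
rewrite horner_mx_poly; apply: memv_suml => i _; apply/memvZ/memv_span.
by rewrite mem_nth // size_tuple.
Qed.

(** A linear dependence among [1, A, ..., A^d] is a nonzero polynomial of degree at most [d]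
    annihilating [A]. *)
Lemma dim_span_powers A :
  (\dim (span_powers d A) == d.+1)%N = (d < degree_mxminpoly A)%N.
Proof.
rewrite span_powersE; set t := [tuple _ | k < _].
have -> : (\dim <<t>> == d.+1)%N = free t by rewrite /free size_tuple.
apply/freeP/idP => [freeA | ltd c c0 i].
  rewrite ltnNge; apply/negP => led.
  (* The minimal polynomial now has degree at most [d], so freeness would kill all its coefficients,
     even the leading 1. *)
  have mE : mxminpoly A = \poly_(i < d.+1) (mxminpoly A)`_i.
    apply/polyP => i; rewrite coef_poly; case: ltnP => // ltdi.
    by rewrite nth_default // size_mxminpoly (leq_ltn_trans led).
  have /eqP := mx_root_minpoly A; rewrite mE horner_mx_poly => /eqP.
  have ltm : (degree_mxminpoly A < d.+1)%N by [].
  move/(freeA (fun i => (mxminpoly A)`_i))/(_ (Ordinal ltm)) => /= m0.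
  have := monic_neq0 (mxminpoly_monic A).
  by rewrite -lead_coef_eq0 lead_coefE size_mxminpoly /= m0 eqxx.
have /mxminpoly_min/dvdp_leq : horner_mx A (\poly_(i < d.+1) c (inord i)) = 0.
  by rewrite horner_mx_poly -[RHS]c0; apply: eq_bigr => j _; rewrite inord_val.
have [p0 _ | _ /(_ isT)] := eqVneq (\poly_(i < d.+1) c (inord i)) 0.
  have := congr1 (fun p : {poly R} => p`_i) p0.
  by rewrite coef_poly ltn_ord inord_val coef0.
by rewrite size_mxminpoly leqNgt ltnS (leq_trans (size_poly _ _)).
Qed.

Lemma distinct_eigenvalues_ltn_degree M :
  has_distinct_eigenvalues M d.+1 -> (d < degree_mxminpoly M)%N.
Proof.
case=> s [us szs sM]; rewrite -ltnS -size_mxminpoly -szs.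
apply: max_poly_roots => //; first exact/monic_neq0/mxminpoly_monic.
by apply/allP => a; rewrite sM eigenvalue_root_min.
Qed.

(** The entries of [s] are distinct roots, so the degree bound leaves no room for a further factor
    or a multiplicity. *)
Lemma mxminpoly_prod_XsubC A (s : seq R) :
    uniq s -> (forall a, (a \in s) = eigenvalue A a) ->
    (degree_mxminpoly A <= size s)%N ->
  mxminpoly A = \prod_(a <- s) ('X - a%:P).
Proof.
move=> us sA led; have mA := mxminpoly_monic A.
have rA : all (root (mxminpoly A)) s.
  by apply/allP => a; rewrite sA eigenvalue_root_min.
have szA : size (mxminpoly A) = (size s).+1.
  apply/eqP; rewrite eqn_leq size_mxminpoly ltnS led -size_mxminpoly.
  by rewrite max_poly_roots // monic_neq0.
rewrite [LHS](all_roots_prod_XsubC szA rA) ?uniq_rootsE //.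
by rewrite (monicP mA) scale1r.
Qed.

Lemma horner_mx_distinct_eigenvalues A q :
    has_distinct_eigenvalues A d.+1 -> degree_mxminpoly A = d.+1 ->
    (d < degree_mxminpoly (horner_mx A q))%N ->
  has_distinct_eigenvalues (horner_mx A q) d.+1.
Proof.
case=> s [us szs sA] degA ltd; set M := horner_mx A q in ltd *.
pose t := undup [seq q.[a] | a <- s].
pose g := \prod_(b <- t) ('X - b%:P).
have szt : (size t <= d.+1)%N
  by rewrite (leq_trans (size_undup _)) // size_map szs.
(* [g] annihilates [M] when the minimal polynomial of [A] divides [g \Po q]. The former is a product
   of distinct linear factors, so it suffices that each of its roots [a] has [q.[a]] in [t]. *)
have gM : mxminpoly M %| g.
  apply/mxminpoly_minP; rewrite -horner_mx_comp; apply/mxminpoly_minP.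
  rewrite (mxminpoly_prod_XsubC _ _ us sA) ?degA ?szs //.
  apply: uniq_roots_dvdp; rewrite ?uniq_rootsE //; apply/allP => a sa.
  by rewrite /root horner_comp -/(root _ _) root_prod_XsubC mem_undup map_f.
have g0 : g != 0 by rewrite monic_neq0 ?monic_prod_XsubC.
have szg : size g = (size t).+1 by rewrite size_prod_XsubC.
have := dvdp_leq g0 gM; rewrite size_mxminpoly szg ltnS => leMt.
have sztE : size t = d.+1 by apply/eqP; rewrite eqn_leq szt (leq_trans ltd).
(* Equal degrees turn divisibility into equality up to a unit, so the eigenvalues of [M] are exactly
   the entries of [t]. *)
have gE : mxminpoly M %= g.
  by rewrite -dvdp_size_eqp // size_mxminpoly szg eqSS eqn_leq leMt sztE.
exists t; split=> // [|b]; first exact: undup_uniq.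
by rewrite eigenvalue_root_min (eqp_root gE) root_prod_XsubC.
Qed.

End SpanPowers.

Lemma scalar_mx_distinct_eigenvalues (R : rcfType) (n : nat) (c : R) :
  has_distinct_eigenvalues (c%:M : 'M[R]_n.+1) 1.
Proof.
exists [:: c]; split=> // a; rewrite inE; apply/idP/eigenvalueP.
  move=> /eqP ->; exists (const_mx 1); first by rewrite mul_mx_scalar.
  by apply/eqP => /matrixP/(_ 0 0)/eqP; rewrite !mxE oner_eq0.
case=> v; rewrite mul_mx_scalar => /eqP.
by rewrite -subr_eq0 -scalerBl scaler_eq0 subr_eq0 eq_sym => /orP[|->].
Qed.

Lemma span_powers_eq_distinct_eigenvalues (R : rcfType) (n d : nat)
    (A M : 'M[R]_n.+1) :
    has_distinct_eigenvalues A d.+1 ->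
    (forall B C, B \in span_powers d A -> C \in span_powers d A ->
       B *m C \in span_powers d A) ->
    M \in span_powers d A ->
  has_distinct_eigenvalues M d.+1 <-> span_powers d A = span_powers d M.
Proof.
move=> eigA mulV VM.
have V1 : 1 \in span_powers d A.
  by apply/mem_span_powersP; exists 1; rewrite ?size_poly1 ?rmorph1.
have VX B m : B \in span_powers d A -> B ^+ m \in span_powers d A.
  by move=> VB; elim: m => [|m IHm]; rewrite ?expr0 // exprS; apply: mulV.
have ltA := distinct_eigenvalues_ltn_degree _ _ _ _ eigA.
have /eqP dimV : \dim (span_powers d A) == d.+1 by rewrite dim_span_powers.
split=> [/distinct_eigenvalues_ltn_degree | eqV].
  rewrite -dim_span_powers => /eqP dimM; apply/esym/eqP.
  rewrite eqEdim dimV dimM leqnn andbT; apply/span_subvP => B /mapP[m _ ->].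
  exact: VX.
have ltM : (d < degree_mxminpoly M)%N by rewrite -dim_span_powers -eqV dimV.
have /mem_span_powersP[q szq defM] := VM.
(* For [d = 0] the span holds only scalar matrices and need not contain [A], so [M] is treated
   directly. *)
case: d => [|d'] in eigA mulV VM V1 VX ltA dimV eqV ltM szq *.
  have [c defq] : exists c, q = c%:P by exists q`_0; exact: size1_polyC.
  rewrite defM defq horner_mx_C; exact: scalar_mx_distinct_eigenvalues.
rewrite defM; apply: horner_mx_distinct_eigenvalues; rewrite -?defM //.
(* Closure under products stands in for diagonalizability: with [d = d'.+1], it gives
   [A^(d+1) = p(A)] with [p] of degree at most [d], so [X^(d+1) - p] annihilates [A]. *)
apply/eqP; rewrite eqn_leq ltA andbT -ltnS -size_mxminpoly.
have VA : A \in span_powers d'.+1 A.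
  by apply/mem_span_powersP; exists 'X; rewrite ?size_polyX ?horner_mx_X.
have /mem_span_powersP[p szp defAd] := VX A d'.+2 VA.
have szXp : size ('X^(d'.+2) - p) = d'.+3.
  by rewrite size_polyDl size_polyXn // size_polyN.
rewrite -szXp dvdp_leq -?size_poly_gt0 ?szXp //; apply/mxminpoly_min.
by rewrite rmorphB rmorphXn /= horner_mx_X -defAd subrr.
Qed.

Theorem theorem1p7 (R : rcfType) (X : finType) (e : rel X)
  (e_sym : symmetric e) (e_irr : irreflexive e)
  (e_conn : forall x y : X, connect e x y)
  (d : nat)
  (A_eig : has_distinct_eigenvalues (adjmx R e) d.+1)
  (e_qp : quotient_polynomial R e d)
  (F : 'I_d.+1 -> 'M[R]_#|X|)
  (F_std : standard_basis (span_powers d (adjmx R e)) F)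
  (F_0 : F ord0 = 1%:M)
  (k : 'I_d.+1) :
  has_distinct_eigenvalues (F k) d.+1 <->
  <<[seq F i | i : 'I_d.+1]>>%VS = span_powers d (F k).
Proof.
clear e_sym e_irr e_conn e_qp F_0.
move: (adjmx R e) A_eig F F_std.
case: #|X| => [|n] A eigA F stdF.
  (* On an empty vertex set every matrix is zero, which [sb_neq0] excludes. *)
  by have /eqP[] := sb_neq0 stdF k; apply/matrixP => [[]].
have spanF := span_basis (sb_basis stdF).
rewrite spanF; apply: span_powers_eq_distinct_eigenvalues => //.
  (* By bilinearity, closure under products reduces to the products [F i *m F j]. *)
  rewrite -spanF => B C.
  move=> /(@coord_span _ _ _ [tuple F i | i < _]) ->.
  move=> /(@coord_span _ _ _ [tuple F i | i < _]) ->.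
  rewrite mulmx_suml; apply: memv_suml => i _.
  rewrite mulmx_sumr; apply: memv_suml => j _.
  rewrite -!tnth_nth !tnth_mktuple -scalemxAl -scalemxAr.
  by do 2!apply: memvZ; exact: sb_mul stdF i j.
by rewrite -spanF memv_span // map_f // mem_enum.
Qed.
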